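(* Let $n \geq 2$ be an integer, $0 < p < 1$, and $T$ a real number with $1 \leq T \leq n$. If $T \leq \left\lfloor \frac{1}{p} \right\rfloor$, then $\bar{\mathbf{x}}(n,T,m)$ with $m = \lfloor T \rfloor$ is an optimal symmetric allocation.
   Context: There are $n$ storage nodes; an allocation stores an amount $x_i \geq 0$ of data in node $i$, with $\sum_{i=1}^n x_i \leq T$. Each node is accessed independently with probability $p$; recovery is successful iff the total amount of data in the accessed nodes is at least $1$. For $m \in \{1,2,\ldots,n\}$, the symmetric allocation $\bar{\mathbf{x}}(n,T,m)$ is the one in which $m$ nodes each store $\frac{T}{m}$ and the remaining $n-m$ nodes store $0$. Its probability of successful recovery is $$P_{\mathrm{S}}(p,T,m) = \mathbb{P}\left[\mathcal{B}(m,p) \geq \left\lceil \tfrac{m}{T} \right\rceil\right],$$ where $\mathcal{B}(m,p)$ denotes a binomial random variable with $m$ trials and success probability $p$. An optimal symmetric allocation is an allocation $\bar{\mathbf{x}}(n,T,m)$ whose $m$ maximizes $P_{\mathrm{S}}(p,T,m)$ over all $m \in \{1,2,\ldots,n\}$. *)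

(* Defs.v *)
From HB Require Import structures.
From mathcomp Require Import all_boot all_order all_algebra.
From mathcomp Require Import all_classical all_reals all_analysis.

Set Implicit Arguments.
Unset Strict Implicit.
Unset Printing Implicit Defensive.

Import Order.TTheory GRing.Theory Num.Theory.

Local Open Scope classical_set_scope.
Local Open Scope ring_scope.

(* Amounts stored in the n nodes; by convention the m nonempty nodes are the
   first m ones (the nodes being exchangeable, only their number matters). *)
Definition symmetric_allocation (R : realType) (n : nat) (T : R) (m : nat) :
    {ffun 'I_n -> R} :=
  [ffun i : 'I_n => if (i < m)%N then T / m%:R else 0].

(* Pr[B(m, p) >= ceil(m / T)]: with m nodes storing T / m each, at least
   ceil(m / T) of them must be accessed to gather one unit of data. *)
Definition success_prob (R : realType) (p T : R) (m : nat) : \bar R :=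
  binomial_prob m p [set k : nat | Num.ceil (m%:R / T) <= k%:Z].

(* For T != 0, the m with x = symmetric_allocation n T m and 1 <= m <= n is
   unique. *)
Definition optimal_symmetric_allocation (R : realType) (n : nat) (p T : R)
    (x : {ffun 'I_n -> R}) : Prop :=
  exists m : nat,
    [/\ (1 <= m <= n)%N, x = symmetric_allocation n T m &
        forall m' : nat, (1 <= m' <= n)%N ->
          (success_prob p T m' <= success_prob p T m)%E].

(* Main.v *)
Require Import Defs.
From HB Require Import structures.
From mathcomp Require Import all_boot all_order all_algebra.
From mathcomp Require Import all_classical all_reals all_analysis.
From mathcomp Require Import zify ring lra.

Import Order.TTheory GRing.Theory Num.Theory.

Local Open Scope ring_scope.

(* If ceil(m / T) = k, then m <= floor(k T), and the probability of fewer than k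
   successes decreases with the number of trials; so it suffices to bound
   Pr[B(floor(k T), p) < k] from below by (1 - p) ^ floor(T), its value at k = 1.
   The core case is that of k s - 1 trials with p <= 1/s: there
   L k = Pr[B(k s - 1, p) < k] is nondecreasing in k. Conditioning on
   Y ~ B(s, p), the number of successes in s further trials,
     L (k + 1) - L k = E[Pr[B(n, p) < k + 1 - Y] - Pr[B(n, p) < k]]
                    >= Pr[B(n, p) = k] (1 - E[1 + r + ... + r^(Y-1)])
   for n = k s - 1 and r = (1 - p) / (p (s - 1)), because consecutive values of
   the probability mass function below k have ratio at most r. Finally
   E[1 + r + ... + r^(Y-1)] = p (1 + u + ... + u^(s-1)) <= 1 with
   u = 1 - p + p r = (1 - p) s / (s - 1) >= 1.
   If T is not an integer, then s = floor(T) + 1 satisfies s <= floor(1 / p) and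
   floor(k T) <= k s - 1. If T = s is an integer, one more trial is added to the
   core case, which multiplies the lower bound by 1 - p. *)

(** * Recurrences for binomial expectations and lower tails *)

Definition binomial_mean {R : realType} n (p : R) (f : nat -> R) :=
  \sum_(i < n.+1) binomial_pmf n p i * f i.

Definition binomial_lt {R : realType} n (p : R) k :=
  \sum_(i < k) binomial_pmf n p i.

Lemma binomial_pmf0 (R : realType) n (p : R) :
  binomial_pmf n p 0 = (1 - p) ^+ n.
Proof. by rewrite /binomial_pmf bin0 expr0 mul1r subn0 mulr1n. Qed.

Lemma binomial_pmf_small (R : realType) n (p : R) k :
  (n < k)%N -> binomial_pmf n p k = 0.
Proof. by move=> nk; rewrite /binomial_pmf bin_small. Qed.

Lemma binomial_pmfS (R : realType) n (p : R) k :
  binomial_pmf n.+1 p k.+1 =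
  (1 - p) * binomial_pmf n p k.+1 + p * binomial_pmf n p k.
Proof.
rewrite /binomial_pmf /unstable.onem subSS binS.
have [nk|kn] := leqP n k.
  rewrite (@bin_small _ k.+1)// add0n mulr0n mulr0 add0r exprS.
  by rewrite -!mulrnAr mulrA.
rewrite -(subnSK kn) mulrnDr !exprS -!mulrnAr.
by congr (_ + _); ring.
Qed.

(** Conditioning on one trial. At [k = 0] the truncated [k.-1] does no harm, as all the sums are
    empty. *)
Lemma binomial_ltS (R : realType) n (p : R) k :
  binomial_lt n.+1 p k =
  (1 - p) * binomial_lt n p k + p * binomial_lt n p k.-1.
Proof.
rewrite /binomial_lt; case: k => [|k /=]; first by rewrite !big_ord0 !mulr0 addr0.
elim: k => [|k IH].
  by rewrite !big_ord_recr !big_ord0 /= !binomial_pmf0 exprS; ring.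
rewrite [LHS]big_ord_recr IH binomial_pmfS.
rewrite [in RHS]big_ord_recr.
rewrite [\sum_(i < k.+1) binomial_pmf n p i in X in _ = _ + X]big_ord_recr /=.
ring.
Qed.

Lemma binomial_meanS (R : realType) n (p : R) f :
  binomial_mean n.+1 p f =
  (1 - p) * binomial_mean n p f + p * binomial_mean n p (f \o succn).
Proof.
rewrite /binomial_mean [LHS]big_ord_recl /= binomial_pmf0 exprS -binomial_pmf0.
under eq_bigr do rewrite binomial_pmfS mulrDl -!mulrA.
rewrite big_split /= -!mulr_sumr addrA -mulrA -mulrDr; congr (_ * _ + _).
rewrite -[LHS](big_ord_recl n.+1 (fun i => binomial_pmf n p i * f i)).
by rewrite big_ord_recr /= binomial_pmf_small// mul0r addr0.
Qed.

Lemma binomial_mean0 (R : realType) (p : R) f : binomial_mean 0 p f = f 0%N.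
Proof. by rewrite /binomial_mean big_ord1 binomial_pmf0 mul1r. Qed.

Lemma binomial_mean_cst (R : realType) n (p c : R) :
  binomial_mean n p (fun=> c) = c.
Proof.
elim: n => [|n IH]; first by rewrite binomial_mean0.
by rewrite binomial_meanS /comp IH; ring.
Qed.

Lemma binomial_meanD (R : realType) n (p : R) f g :
  binomial_mean n p (fun i => f i + g i) =
  binomial_mean n p f + binomial_mean n p g.
Proof. by rewrite -big_split/=; apply: eq_bigr => i _; rewrite mulrDr. Qed.

Lemma binomial_meanZ (R : realType) n (p c : R) f :
  binomial_mean n p (fun i => c * f i) = c * binomial_mean n p f.
Proof. by rewrite /binomial_mean mulr_sumr; apply: eq_bigr => i _; ring. Qed.

Lemma ler_binomial_mean (R : realType) n (p : R) f g : 0 <= p <= 1 ->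
  (forall i, f i <= g i) -> binomial_mean n p f <= binomial_mean n p g.
Proof.
by move=> p01 fg; apply: ler_sum => i _; rewrite ler_wpM2l ?binomial_pmf_ge0.
Qed.

Lemma binomial_ltD (R : realType) n m (p : R) k :
  binomial_lt (n + m) p k =
  binomial_mean m p (fun i => binomial_lt n p (k - i)).
Proof.
elim: m k => [|m IH] k; first by rewrite addn0 binomial_mean0 subn0.
rewrite addnS binomial_ltS !IH binomial_meanS; congr (_ + _ * _).
by apply: eq_bigr => i _ /=; congr (_ * binomial_lt _ _ _); lia.
Qed.

(** With [u = 1 - p + p * r], the generating function gives E[r^Y] = u^n, and u - 1 = p (r - 1).
    Induction on [n] avoids dividing by r - 1, which may vanish. *)
Lemma binomial_mean_geometric (R : realType) n (p r : R) :
  binomial_mean n p (fun i => \sum_(l < i) r ^+ l) =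
  p * \sum_(l < n) (1 - p + p * r) ^+ l.
Proof.
elim: n => [|n IH]; first by rewrite binomial_mean0 !big_ord0 mulr0.
rewrite binomial_meanS.
have -> : (fun i => \sum_(l < i) r ^+ l) \o succn =
          (fun i => 1 + r * \sum_(l < i) r ^+ l).
  apply/funext => i /=; rewrite big_ord_recl expr0 mulr_sumr; congr (_ + _).
  by apply: eq_bigr => l _; rewrite exprS.
rewrite binomial_meanD binomial_mean_cst binomial_meanZ IH.
rewrite big_ord_recl expr0 /=; under [in RHS]eq_bigr do rewrite exprS.
by rewrite -mulr_sumr; ring.
Qed.

(** * Monotonicity of the lower tail along k s - 1 trials *)

Lemma geometric_sum_le_top (R : realDomainType) n (u : R) :
  1 <= u -> \sum_(l < n.+1) u ^+ l <= n.+1%:R * u ^+ n.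
Proof.
move=> u1; rewrite mulr_natl -[X in _ *+ X]card_ord -sumr_const.
by apply: ler_sum => i _; rewrite ler_weXn2l// -ltnS.
Qed.

(** The exact ratio is (j + 1)(1 - p) / ((n - j) p), and n - j = k s - (j + 1) >= (j + 1)(s - 1)
    since j + 1 <= k. Here s is [t.+2], so that s - 1 is nonzero. *)
Lemma ler_binomial_pmf_ratio (R : realType) n (p : R) t k j :
  0 < p < 1 -> n.+1 = (k * t.+2)%N -> (j < k)%N ->
  binomial_pmf n p j <= (1 - p) / (p * t.+1%:R) * binomial_pmf n p j.+1.
Proof.
move=> /andP[p0 p1] nk jk.
have jn : (j.+1 * t.+1 <= n - j)%N by nia.
have jn0 : (j < n)%N by nia.
have E : (n - j)%:R * p * binomial_pmf n p j =
         j.+1%:R * (1 - p) * binomial_pmf n p j.+1.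
  rewrite /binomial_pmf /unstable.onem -(subnSK jn0) !exprS (subnSK jn0).
  rewrite -(mulr_natl _ 'C(n, j)) -(mulr_natl _ 'C(n, j.+1)).
  have := mul_bin_left n j; move/(congr1 (fun x => x%:R : R)).
  rewrite !natrM => F.
  transitivity (((n - j)%:R * 'C(n, j)%:R) *
      (p * p ^+ j * ((1 - p) * (1 - p) ^+ (n - j.+1)))).
    by ring.
  by rewrite -F; ring.
have b0 : 0 <= binomial_pmf n p j by apply: binomial_pmf_ge0; lra.
have j0 : (0 : R) < j.+1%:R by rewrite ltr0n.
have t0 : (0 : R) < t.+1%:R by rewrite ltr0n.
rewrite mulrAC ler_pdivlMr ?mulr_gt0//.
rewrite -(ler_pM2l j0) [leRHS]mulrA -E.
have : (j.+1%:R * t.+1%:R : R) <= (n - j)%:R by rewrite -natrM ler_nat.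
move=> /(ler_wpM2r (mulr_ge0 (ltW p0) b0)); lra.
Qed.

(** For i >= 1 the term [l = 0] cancels [binomial_pmf n p k]; each further [l] pays for the loss of
    the mass at k - l. *)
Lemma binomial_lt_shift (R : realType) n (p : R) t k i :
  0 < p < 1 -> n.+1 = (k * t.+2)%N ->
  binomial_lt n p k + binomial_pmf n p k *
    (1 - \sum_(l < i) ((1 - p) / (p * t.+1%:R)) ^+ l) <=
  binomial_lt n p (k.+1 - i).
Proof.
move=> p01 nk; set r := (1 - p) / _; case/andP: (p01) => p0 p1.
have r0 : 0 <= r by rewrite divr_ge0 ?mulr_ge0//; lra.
have b0 j : 0 <= binomial_pmf n p j by apply: binomial_pmf_ge0; lra.
case: i => [|i].
  by rewrite big_ord0 subr0 mulr1 subn0 /binomial_lt big_ord_recr.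
have ratio j : (j <= k)%N ->
    binomial_pmf n p (k - j) <= r ^+ j * binomial_pmf n p k.
  elim: j => [|j IH] jk; first by rewrite subn0 expr0 mul1r.
  rewrite exprS -mulrA.
  apply: le_trans (ler_wpM2l r0 (IH (ltnW jk))).
  by rewrite -(subnSK jk); apply: (@ler_binomial_pmf_ratio _ _ _ _ k) => //; lia.
rewrite subSS; elim: i => [|i IH].
  by rewrite big_ord1 expr0 subrr mulr0 addr0 subn0.
rewrite big_ord_recr /=.
(* Once the truncated [k - i] has reached 0, the right side stays constant while the left side can
   only decrease. *)
have [ik|ki] := ltnP i k; last first.
  have -> : (k - i.+1 = k - i)%N by lia.
  apply: le_trans IH; rewrite lerD2l ler_wpM2l// lerD2l lerN2 lerDl.
  by rewrite exprn_ge0.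
have E : binomial_lt n p (k - i) =
  binomial_lt n p (k - i.+1) + binomial_pmf n p (k - i.+1).
  by rewrite -(subnSK ik) /binomial_lt big_ord_recr.
have := ratio _ ik; move: IH; rewrite E; lra.
Qed.

Lemma binomial_lt_mono_step (R : realType) n (p : R) t k :
  0 < p -> p * t.+2%:R <= 1 -> n.+1 = (k * t.+2)%N ->
  binomial_lt n p k <= binomial_lt (n + t.+2) p k.+1.
Proof.
move=> p0 pt nk.
have t0 : (0 : R) < t.+1%:R by rewrite ltr0n.
have ts : t.+2%:R = t.+1%:R + 1 :> R by rewrite -natr1.
have p1 : p < 1.
  rewrite (lt_le_trans _ pt)// ltr_pMr//; rewrite ts; lra.
have p01 : 0 < p < 1 by rewrite p0 p1.
rewrite binomial_ltD; set r := (1 - p) / (p * t.+1%:R).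
apply: le_trans (ler_binomial_mean _ _ _ _ _ _
  (fun i => binomial_lt_shift _ _ _ _ _ _ p01 nk)); last by rewrite !ltW.
rewrite -/r binomial_meanD binomial_meanZ binomial_mean_cst lerDl.
apply: mulr_ge0; first by apply: binomial_pmf_ge0; rewrite !ltW.
have -> : (fun i => 1 - \sum_(l < i) r ^+ l) =
   (fun i => 1 + -1 * \sum_(l < i) r ^+ l).
  by apply/funext => i; rewrite mulN1r.
rewrite binomial_meanD binomial_meanZ binomial_mean_cst mulN1r subr_ge0.
rewrite binomial_mean_geometric; set u := 1 - p + p * r.
have uE : u * t.+1%:R = t.+2%:R * (1 - p).
  rewrite /u /r ts; field; lra.
have u1 : 1 <= u by rewrite -(ler_pM2r t0) mul1r uE ts; move: pt; rewrite ts; lra.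
(* As [p = 1 - u (s-1)/s], the bound [p (1 + ... + u^(s-1)) <= 1] reduces to
   [1 + ... + u^(s-1) <= s u^(s-1)]. *)
have := geometric_sum_le_top R t.+1 u u1.
have := subrX1 u t.+2.
set S := \sum_(i < t.+2) u ^+ i => uS Sle.
have s0 : (0 : R) < t.+2%:R by rewrite ltr0n.
rewrite -(ler_pM2l s0) mulr1.
have -> : t.+2%:R * (p * S) = t.+2%:R * S - (t.+2%:R * (1 - p)) * S by ring.
rewrite -uE.
have -> : t.+2%:R * S - u * t.+1%:R * S =
  t.+2%:R - t.+2%:R * u ^+ t.+2 + u * S.
  have -> : u ^+ t.+2 = 1 + (u - 1) * S by rewrite -uS; ring.
  rewrite ts; ring.
have u0 : 0 <= u by lra.
have := ler_wpM2l u0 Sle; rewrite mulrCA -exprS; lra.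
Qed.

(** * Lower bounds by the value at k = 1 *)

Lemma expr_le_binomial_lt_pred (R : realType) (p : R) s k :
  0 < p < 1 -> p * s.+1%:R <= 1 ->
  (1 - p) ^+ s <= binomial_lt (k.+1 * s.+1).-1 p k.+1.
Proof.
move=> p01 ps; case/andP: (p01) => p0 p1.
(* The monotonicity step needs block length at least 2. With blocks of length 1 there are [k]
   trials, so fewer than [k.+1] successes is certain. *)
case: s ps => [_|t pt].
  rewrite muln1 /= expr0 /binomial_lt.
  have := binomial_mean_cst R k p 1; rewrite /binomial_mean => E.
  by rewrite -[leLHS]E; apply: ler_sum => i _; rewrite mulr1.
elim: k => [|k IH]; first by rewrite mul1n /= /binomial_lt big_ord1 binomial_pmf0.
apply: le_trans IH _.
have -> : (k.+2 * t.+2).-1 = ((k.+1 * t.+2).-1 + t.+2)%N by lia.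
by apply: binomial_lt_mono_step => //; lia.
Qed.

Lemma expr_le_binomial_lt (R : realType) (p : R) s k :
  0 < p < 1 -> p * s.+1%:R <= 1 ->
  (1 - p) ^+ s.+1 <= binomial_lt (k.+1 * s.+1) p k.+1.
Proof.
move=> p01 ps; case/andP: (p01) => p0 p1.
have -> : (k.+1 * s.+1 = (k.+1 * s.+1).-1.+1)%N by lia.
rewrite binomial_ltS exprS -[leLHS]addr0 lerD//.
  by rewrite ler_wpM2l ?expr_le_binomial_lt_pred//; lra.
rewrite mulr_ge0 ?sumr_ge0//; first lra.
by move=> i _; apply: binomial_pmf_ge0; lra.
Qed.

(** Successes in the additional trials only lower the threshold left for the first [m]. *)
Lemma ler_binomial_lt (R : realType) (p : R) m n k :
  0 <= p <= 1 -> (m <= n)%N -> binomial_lt n p k <= binomial_lt m p k.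
Proof.
move=> p01 /subnKC <-; rewrite binomial_ltD.
rewrite -[leRHS](binomial_mean_cst R (n - m) p); apply: ler_binomial_mean => // i.
rewrite /binomial_lt -!(big_mkord xpredT (fun j => binomial_pmf m p j)).
rewrite [leRHS](@big_cat_nat _ _ _ (k - i)%N)//= ?leq_subr// lerDl sumr_ge0// => j _.
exact: binomial_pmf_ge0.
Qed.

(** * Success probabilities and optimality *)

Lemma binomial_prob_ge (R : realType) n (p : R) k : 0 <= p <= 1 ->
  binomial_prob n p [set i | (k <= i)%N]%classic = (1 - binomial_lt n p k)%:E.
Proof.
move=> p01.
have -> : [set i | (k <= i)%N]%classic = (~` `I_k)%classic.
  by apply/funext => i; apply/propext; split=> /=;
    [rewrite leqNgt => /negP|move=> /negP; rewrite -leqNgt].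
rewrite probability_setC// EFinB; congr (_ - _)%E.
rewrite /= /binomial_prob p01 esum_fset//; last first.
  by move=> i _; rewrite lee_fin binomial_pmf_ge0.
by rewrite -fsbig_ord sumEFin.
Qed.

Lemma success_probE (R : realType) (p T : R) m k : 0 <= p <= 1 ->
  Num.ceil (m%:R / T) = k%:Z ->
  success_prob p T m = (1 - binomial_lt m p k)%:E.
Proof. by move=> p01 mk; rewrite /success_prob mk -binomial_prob_ge. Qed.

Theorem theorem3 (R : realType) (n : nat) (p T : R)
  (hn : (2 <= n)%N) (hp : 0 < p < 1) (hT : 1 <= T <= n%:R)
  (hTp : T <= (Num.floor (1 / p))%:~R) :
  optimal_symmetric_allocation p T
    (symmetric_allocation n T `|Num.floor T|%N).
Proof.
case/andP: (hp) => p0 p1; case/andP: (hT) => T1 Tn.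
have p01 : 0 <= p <= 1 by rewrite !ltW.
set t := `|Num.floor T|%N.
have tE : Num.floor T = t%:Z.
  by rewrite gez0_abs// floor_ge0; lra.
have T0 : 0 < T by lra.
have /andP[tT Tt] : t%:R <= T < t.+1%:R.
  by have := floor_itv T; rewrite tE -[t.+1]addn1 natrD intrD.
have t1 : (0 < t)%N by rewrite -ltz_nat -tE floor_gt0.
have tn : (t <= n)%N by rewrite -(ler_nat R); lra.
exists t; split => // [|m /andP[m1 mn]]; first by rewrite t1.
(* Since 0 < t <= T, a single accessed node suffices, so recovery fails with probability (1 -
   p)^t. *)
have ct : Num.ceil (t%:R / T) = 1%:Z.
  by apply: ceil_def; rewrite subrr divr_gt0 ?ltr0n//= ler_pdivrMr// mul1r.
rewrite (success_probE _ _ _ _ _ p01 ct).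
have [k ck] : exists k : nat, Num.ceil (m%:R / T) = k.+1%:Z.
  have : 0 < Num.ceil (m%:R / T) by rewrite ceil_gt0 divr_gt0// ltr0n.
  by case: (Num.ceil _) => [[//|k]|//]; exists k.
rewrite (success_probE _ _ _ _ _ p01 ck) lee_fin lerD2l lerN2.
rewrite {1}/binomial_lt big_ord1 binomial_pmf0.
have mk : m%:R <= k.+1%:R * T.
  by have := ceil_ge (m%:R / T); rewrite ck ler_pdivrMr.
have [f fE] : exists f : nat, Num.floor (1 / p) = f%:Z.
  exists `|Num.floor (1 / p)|%N; rewrite gez0_abs// floor_ge0.
  by rewrite divr_ge0//; lra.
have pf : p * f%:R <= 1.
  have := floor_le (1 / p); rewrite fE ler_pdivlMr//; lra.
rewrite fE /= in hTp.
have [tTe|tTne] := eqVneq (t%:R : R) T.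
  have mkt : (m <= k.+1 * t)%N by rewrite -(ler_nat R) natrM tTe.
  apply: le_trans (ler_binomial_lt _ _ _ _ _ p01 mkt).
  case: t t1 tTe {tE tT Tt tn ct mkt} => // t _ tTe.
  apply: expr_le_binomial_lt => //; rewrite tTe.
  by apply: le_trans pf; rewrite ler_pM2l.
have tltT : t%:R < T by rewrite lt_neqAle tTne.
(* From t < T <= f with [f] an integer, blocks of length [t.+1] still satisfy p (t + 1) <= p f <=
   1. *)
have tf : (t < f)%N by rewrite -(ltr_nat R); lra.
have mkt : (m <= (k.+1 * t.+1).-1)%N.
  suff : (m < k.+1 * t.+1)%N by lia.
  rewrite -(ltr_nat R) natrM; apply: le_lt_trans mk _.
  by rewrite ltr_pM2l// ltr0n.
apply: le_trans (ler_binomial_lt _ _ _ _ _ p01 mkt).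
apply: expr_le_binomial_lt_pred => //.
by apply: le_trans pf; rewrite ler_pM2l// ler_nat.
Qed.
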